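(* For almost all cubefree $n$ we have $\operatorname{gnu}(n)\leq (\log n)^{(\log\log n)^{O(1)}}$, and so $\operatorname{gnu}(n)\leq n^{o(1)}$. That is, there are a constant $c>0$ and a set $T$ of cubefree positive integers which has density $1$ in the set of all cubefree positive integers, such that \[\operatorname{gnu}(n)\leq (\log n)^{(\log\log n)^{c}}\qquad\text{for all } n\in T,\] and consequently there is a function $\varepsilon\colon T\to\mathbb{R}$ with $\varepsilon(n)\to 0$ as $n\to\infty$ in $T$ such that $\operatorname{gnu}(n)\leq n^{\varepsilon(n)}$ for all $n\in T$.
   Context: A positive integer $n$ is cubefree if it is not divisible by $p^3$ for any prime $p$. $\operatorname{gnu}(n)$ denotes the number of isomorphism types of groups of order $n$. ''For almost all cubefree $n$'' means: for all $n$ in a set $T$ of cubefree integers such that $|T\cap[1,x]|/|\{k\leq x: k\text{ cubefree}\}|\to 1$ as $x\to\infty$. (Finitely many small $n$, for which the iterated logarithm is not meaningful, may be left out of $T$.) *)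

(* Defs.v *)
From HB Require Import structures.
From mathcomp Require Import all_boot all_order all_algebra all_fingroup.
Set Implicit Arguments.
Unset Strict Implicit.
Unset Printing Implicit Defensive.

(* Every group of order n is isomorphic to one with carrier 'I_n, so groups of
   order n are counted through their multiplication tables on 'I_n. *)
Definition group_table n (m : {ffun 'I_n * 'I_n -> 'I_n}) : bool :=
  [forall x, forall y, forall z, m (m (x, y), z) == m (x, m (y, z))] &&
  [exists e, [forall x, (m (e, x) == x) && (m (x, e) == x)] &&
             [forall x, exists y, (m (y, x) == e) && (m (x, y) == e)]].

Definition table_iso n (m1 m2 : {ffun 'I_n * 'I_n -> 'I_n}) : bool :=
  [exists s : {perm 'I_n},
    forall x, forall y, s (m1 (x, y)) == m2 (s x, s y)].

Definition gnu (n : nat) : nat :=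
  #|equivalence_partition (@table_iso n) [set m | @group_table n m]|.

Section GnuSpec.

Section TableGroup.
Variables (n : nat) (m : {ffun 'I_n * 'I_n -> 'I_n}).

Definition table_group of group_table m : Type := 'I_n.

Hypothesis gm : group_table m.
HB.instance Definition _ := Finite.on (table_group gm).

Let e_ex : {e : 'I_n | [forall x, (m (e, x) == x) && (m (x, e) == x)] &&
             [forall x, exists y, (m (y, x) == e) && (m (x, y) == e)]}.
Proof. by apply: sigW; have /andP[_ /existsP] := gm. Qed.

Let inv_ex x : {y : 'I_n | (m (y, x) == sval e_ex) && (m (x, y) == sval e_ex)}.
Proof.
apply: sigW; have /andP[_ /forallP/(_ x)/existsP[y hy]] := svalP e_ex.
by exists y.
Qed.

Let tmul (x y : table_group gm) : table_group gm := m (x, y).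
Let tone : table_group gm := sval e_ex.
Let tinv (x : table_group gm) : table_group gm := sval (inv_ex x).

Let tmulA : associative tmul.
Proof.
move=> x y z; have /andP[/forallP/(_ x)/forallP/(_ y)/forallP/(_ z)/eqP h _] := gm.
by rewrite /tmul h.
Qed.

Let tmul1 : left_id tone tmul.
Proof. by move=> x; have /andP[/forallP/(_ x)/andP[/eqP]] := svalP e_ex. Qed.

Let tmulV : left_inverse tone tinv tmul.
Proof. by move=> x; have /andP[/eqP] := svalP (inv_ex x). Qed.

HB.instance Definition _ :=
  Finite_isGroup.Build (table_group gm) tmulA tmul1 tmulV.

Lemma table_groupM (x y : table_group gm) : (x * y)%g = m (x, y).
Proof. by []. Qed.
End TableGroup.

Lemma table_isoP n (m1 m2 : {ffun 'I_n * 'I_n -> 'I_n})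
    (g1 : group_table m1) (g2 : group_table m2) :
  table_iso m1 m2 = ([set: table_group g1] \isog [set: table_group g2])%g.
Proof.
apply/idP/idP => [/existsP[s /forallP hs]|/isogP[f /injmP injf _]].
  pose f (x : table_group g1) : table_group g2 := s x.
  have fM : {in [set: table_group g1] &, {morph f : x y / (x * y)%g}}.
    by move=> x y _ _; have /forallP/(_ y)/eqP := hs x.
  apply/isogP; exists (Morphism fM); first by apply/injmP => x y _ _ /perm_inj.
  apply/setP => y; rewrite inE; apply/morphimP.
  exists (s^-1 y)%g; rewrite ?inE //=.
  by rewrite /f permKV.
have injf' : injective (f : 'I_n -> 'I_n) by move=> x y; apply: injf; rewrite inE.
apply/existsP; exists (perm injf'); apply/forallP => x; apply/forallP => y.
by rewrite !permE; apply/eqP; apply: (morphM f); rewrite inE.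
Qed.

Lemma table_iso_equiv n :
  {in [set m | @group_table n m] & &, equivalence_rel (@table_iso n)}.
Proof.
move=> a b c; rewrite !inE => ga gb gc.
rewrite (table_isoP gc gc) (table_isoP ga gb) (table_isoP ga gc) (table_isoP gb gc).
by split=> [|ab]; [exact: (isog_refl [group of [set: _]]) | exact: (isog_transl [group of [set: _]] ab)].
Qed.

Lemma gnuP n : exists G : 'I_(gnu n) -> finGroupType,
  [/\ forall i, #|G i| = n,
      forall i j, ([set: G i] \isog [set: G j])%g -> i = j
    & forall H : finGroupType, #|H| = n ->
        exists i, ([set: H] \isog [set: G i])%g].
Proof.
pose D := [set m | @group_table n m].
pose P := equivalence_partition (@table_iso n) D.
have partP : partition P D by apply: equivalence_partitionP; exact: table_iso_equiv.
have [/eqP covP tiP _] := and3P partP.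
have rep (i : 'I_(gnu n)) :
    {m : {ffun 'I_n * 'I_n -> 'I_n} | m \in D & pblock P m = enum_val i}.
  have iP : enum_val i \in P by exact: enum_valP.
  have : exists m : {ffun 'I_n * 'I_n -> 'I_n},
      (m \in D) && (pblock P m == enum_val i).
    have [m mi] : exists m, m \in enum_val i.
      by apply/set0Pn; apply: (partition_neq0 partP iP).
    exists m; rewrite (def_pblock tiP iP mi) eqxx andbT.
    by rewrite -covP; apply/bigcupP; exists (enum_val i).
  by case/sigW => m /andP[mD /eqP mi]; exists m.
have gt i : group_table (s2val (rep i)).
  by have := s2valP (rep i); rewrite inE.
have isoE a b : a \in D -> b \in D -> table_iso a b = (pblock P a == pblock P b).
  move=> aD bD; rewrite eq_pblock ?covP //.
  by rewrite pblock_equivalence_partition //; exact: table_iso_equiv.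
exists (fun i => table_group (gt i) : finGroupType); split.
- by move=> i; rewrite -[RHS]card_ord.
- move=> i j; rewrite -table_isoP isoE ?(s2valP (rep _)) //.
  by rewrite !(s2valP' (rep _)) => /eqP/enum_val_inj.
move=> H cH.
pose r (x : H) : 'I_n := cast_ord cH (enum_rank x).
pose u (i : 'I_n) : H := enum_val (cast_ord (esym cH) i).
have ru : cancel u r by move=> i; rewrite /r /u enum_valK cast_ordKV.
have ur : cancel r u by move=> x; rewrite /r /u cast_ordK enum_rankK.
pose m : {ffun 'I_n * 'I_n -> 'I_n} := [ffun p => r (u p.1 * u p.2)%g].
have gm : group_table m.
  apply/andP; split.
    apply/forallP => x; apply/forallP => y; apply/forallP => z.
    by rewrite !ffunE /= !ur mulgA.
  apply/existsP; exists (r 1%g); apply/andP; split; apply/forallP => x.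
    by rewrite !ffunE /= !ur mul1g mulg1 ru eqxx.
  by apply/existsP; exists (r (u x)^-1%g); rewrite !ffunE /= !ur mulVg mulgV eqxx.
have mD : m \in D by rewrite inE.
have bP : pblock P m \in P by apply: pblock_mem; rewrite covP.
exists (enum_rank_in bP (pblock P m)).
set i := enum_rank_in _ _.
have Hm : ([set: H] \isog [set: table_group gm])%g.
  pose f (x : H) : table_group gm := r x.
  have fM : {in [set: H] &, {morph f : x y / (x * y)%g}}.
    by move=> x y _ _; rewrite /f table_groupM ffunE /= !ur.
  apply/isogP; exists (Morphism fM).
    by apply/injmP => x y _ _; apply: (can_inj ur).
  apply/setP => y; rewrite inE; apply/morphimP.
  by exists (u y); rewrite ?inE //= /f ru.
apply: isog_trans Hm _; rewrite -table_isoP isoE ?(s2valP (rep _)) //.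
by rewrite (s2valP' (rep _)) /i enum_rankK_in.
Qed.

End GnuSpec.

From mathcomp Require Import all_classical all_reals all_analysis.
Import Order.TTheory GRing.Theory Num.Theory.
Import numFieldNormedType.Exports.
Local Open Scope classical_set_scope.
Local Open Scope ring_scope.

Definition cubefree : set nat :=
  [set n | (0 < n)%N /\ forall p : nat, prime p -> ~~ (p ^ 3 %| n)%N].

Definition count_upto (A : set nat) (x : nat) : nat :=
  (\sum_(1 <= k < x.+1) (k \in A))%N.

Definition relative_density_one (R : realType) (B A : set nat) : Prop :=
  (count_upto A x)%:R / (count_upto B x)%:R @[x --> \oo] --> (1 : R).

(* Main.v *)
Require Import Defs.
From mathcomp Require Import all_boot all_order all_algebra all_fingroup.
From mathcomp Require Import all_solvable all_field.
From mathcomp Require Import zify.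
Set Implicit Arguments.
Unset Strict Implicit.
Unset Printing Implicit Defensive.

(* Let the parameter J grow extremely slowly with n. For almost all cubefree n the
   following holds for every prime q >= 4^J dividing n: q^2 does not divide n, and n has
   no divisor d > 1 with d = 1 mod q all of whose prime factors are below q. Indeed, for
   q in [4^j, 4^(j+1)), such a d of size at most 2^(2^j) occurs with density
   O(sum_q q^-2 log (2^(2^j))) = O(2^-j), while a larger one forces n to have an
   abnormal number of small divisors, an event of density O(j^2 2^-j); both are summable
   over j. By Sylow's theorem, if the order of a group is the q-smooth part of n,
   its Sylow q-subgroup is then normal of order q, hence has a complement H by Schur-Zassenhaus,
   and the group is determined by H and a homomorphism H -> (Z/q)^*. The same sieve
   condition with d prime bounds the prime factors of gcd(|H|, q - 1) by a power of
   log n, and typically n has O(log log n) prime factors, so there are few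
   homomorphisms. Peeling off all the primes q >= 4^J in decreasing order leaves a group
   of order at most log log n, for which counting all multiplication tables suffices. *)

(** * Groups with a normal Sylow subgroup of prime order *)

Lemma gnu_le_tables n : gnu n <= n ^ (n * n).
Proof.
apply: leq_trans (leq_imset_card _ _) _.
by rewrite (leq_trans (max_card _)) // card_ffun card_prod card_ord.
Qed.

(** Codes form a relation, so a group may have many codes and none has to be canonical; choosing one
    code per isomorphism type gives an injection into [F]. *)
Lemma gnu_le_code n (F : finType) (C : finGroupType -> F -> Prop) :
    (forall G : finGroupType, #|G| = n -> exists c, C G c) ->
    (forall (G H : finGroupType) c, C G c -> C H c ->
       ([set: G] \isog [set: H])%g) ->
  gnu n <= #|F|.
Proof.
move=> exC injC; have [G [cardG isoG _]] := gnuP n.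
have /fin_all_exists[c cP] i : exists c, C (G i) c by apply: exC.
rewrite -[leqLHS]card_ord; apply: (@leq_card _ _ c) => i j cij.
by apply: isoG; apply: injC (cP i) _; rewrite cij.
Qed.

Lemma leq_expn a b e : a <= b -> a ^ e <= b ^ e.
Proof. by case: e => // e ab; rewrite leq_exp2r. Qed.

Section Generators.
Local Open Scope group_scope.

(** For [N > n > 0] this is the number of prime factors of [n] with multiplicity; a cutoff
    independent of [n] keeps it additive on products. *)
Definition Omega N n := (\sum_(0 <= p < N) logn p n)%N.

Lemma OmegaM N m n : 0 < m -> 0 < n -> Omega N (m * n) = (Omega N m + Omega N n)%N.
Proof. by move=> m0 n0; rewrite -big_split; apply: eq_bigr => p _; rewrite lognM. Qed.

Lemma Omega_gt0 N n : 1 < n < N -> 0 < Omega N n.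
Proof.
case/andP=> n_gt1 nN; have pn := pdiv_prime n_gt1.
rewrite /Omega (big_cat_nat _ (n := pdiv n)) //=; last first.
  by rewrite (leq_trans (pdiv_leq _)) 1?ltnW // (ltn_trans _ n_gt1).
rewrite [X in _ + X]big_ltn; last by apply: leq_ltn_trans nN; apply: pdiv_leq; apply: ltnW.
by rewrite addnCA ltn_addr // logn_gt0 mem_primes pn pdiv_dvd ltnW.
Qed.

(* Each generator outside the subgroup generated so far adds a prime factor to its order. *)
Lemma exists_generators (gT : finGroupType) (k : nat) :
    Omega #|gT|.+1 #|gT| <= k ->
  exists s : k.-tuple gT, <<[set x in s]>> = [set: gT].
Proof.
move=> le_k.
have [s [szs gen]] : exists s : seq gT, size s = k /\
    (<<[set x in s]>> = [set: gT] \/ k <= Omega #|gT|.+1 #|<<[set x in s]>>|).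
  elim: (k) => [|i [s [szs gen]]]; first by exists [::]; split=> //; right.
  have [full|[x xN]] : (<<[set x in s]>> = [set: gT]) \/ exists x, x \notin <<[set x in s]>>.
    have [/setP h|h] := eqVneq <<[set x in s]>> [set: gT]; first by left; apply/setP.
    right; apply/existsP; apply: contraR h; rewrite negb_exists => /forallP h.
    by apply/eqP/setP=> x; rewrite inE; have := h x; rewrite negbK.
    (* Padding with the identity keeps the length exact once the whole group is generated. *)
    exists (1 :: s); split; first by rewrite /= szs.
    left; apply/eqP; rewrite -subTset -full genS //.
    by apply/subsetP=> x; rewrite !inE => ->; rewrite orbT.
  exists (x :: s); split; first by rewrite /= szs.
  right; case: gen => [full|gen]; first by rewrite full inE in xN.
  set H := <<[set y in s]>> in xN gen *; set K := <<_>>.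
  have sHK : H \subset K.
    by apply: genS; apply/subsetP=> y; rewrite !inE => ->; rewrite orbT.
  have xK : x \in K by apply: mem_gen; rewrite !inE eqxx.
  rewrite -(Lagrange sHK) OmegaM ?cardG_gt0 ?indexg_gt0 //.
  apply: leq_trans (_ : Omega #|gT|.+1 #|H| + 1 <= _)%N; first by rewrite addn1.
  rewrite leq_add2l Omega_gt0 // indexg_gt1; apply/andP; split.
    by apply: contra xN => /subsetP->.
  rewrite ltnS; apply: leq_trans (_ : #|K| <= _); last exact: max_card.
  by rewrite -(Lagrange sHK) leq_pmull.
exists (tcast szs (in_tuple s)); suff -> : [set x in tcast szs (in_tuple s)] = [set x in s].
  (* A proper subgroup would have index above 1, and the index would add a prime factor to the [k]
     already used. *)
  case: gen => // gen; apply/eqP; rewrite eqEcard subsetT cardsT /=.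
  have dH : #|<<[set x in s]>>| %| #|gT| by rewrite -cardsT cardSg ?subsetT.
  rewrite leqNgt; apply/negP=> lt.
  have := leq_trans le_k gen.
  rewrite -{2}(divnK dH) mulnC OmegaM ?cardG_gt0 ?divn_gt0 ?cardG_gt0 ?(ltnW lt) //.
  rewrite -[leqRHS]addn0 leq_add2l leqNgt Omega_gt0 //.
  by rewrite ltn_divRL // mul1n lt ltnS leq_div.
by apply/setP=> x; rewrite !inE; case: k / szs {le_k gen}.
Qed.

End Generators.

Section Peel.
Local Open Scope group_scope.

Lemma conj_expg_iter (gT : finGroupType) (x h : gT) k j :
  x ^ h = x ^+ k -> x ^ (h ^+ j) = x ^+ (k ^ j).
Proof.
move=> xh; elim: j => [|j IH]; first by rewrite conjg1.
by rewrite expgSr conjgM IH conjXg xh -expgM expnS mulnC.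
Qed.

Lemma exp_gcdn (R : nzRingType) (u : R) a b :
  0 < a -> (u ^+ a = 1 -> u ^+ b = 1 -> u ^+ gcdn a b = 1)%R.
Proof.
move=> a0 ua ub; have [k l e _] := egcdnP b a0.
have : (u ^+ (k * a) = 1)%R by rewrite mulnC GRing.exprM ua GRing.expr1n.
by rewrite e GRing.exprD mulnC GRing.exprM ub GRing.expr1n GRing.mul1r.
Qed.

Lemma card_Fp_roots q g : 0 < g -> #|[set u : 'F_q | (u ^+ g == 1)%R]| <= g.
Proof.
move=> g0; rewrite cardE.
apply: (poly.max_unity_roots g0); last exact: enum_uniq.
by apply/allP=> u; rewrite mem_enum inE => /eqP h; apply/poly.unity_rootP.
Qed.

(** The number of Sylow q-subgroups divides [m] and is 1 modulo [q], so the hypothesis on divisors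
    forces it to be 1. *)
Lemma normal_Sylow_prime (gT : finGroupType) q m :
    prime q -> #|gT| = (q * m)%N -> ~~ (q %| m) ->
    (forall d, d %| m -> d %% q = 1 -> d = 1)%N ->
  exists P : {group gT}, [/\ #|P| = q, P <| [set: gT] & coprime #|P| #|[set: gT] : P|].
Proof.
move=> pq cardG qm hd.
have m0 : 0 < m by case: (m) qm; rewrite ?dvdn0.
have /normal_sylowP[P sylP nP] : #|'Syl_q([set: gT])| == 1%N.
  apply/eqP/hd; last exact: card_Syl_mod.
  have := card_Syl_dvd q [set: gT]; rewrite cardsT cardG mulnC Gauss_dvdl //.
  by rewrite coprime_sym prime_coprime // /dvdn card_Syl_mod.
have oP : #|P| = q.
  rewrite (card_Hall sylP) cardsT cardG p_part (lognM _ (prime_gt0 pq) m0).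
  by rewrite logn_prime // eqxx lognE (negbTE qm) !andbF.
exists P; split=> //; rewrite oP prime_coprime //.
rewrite -divgS ?subsetT // cardsT cardG oP mulKn //; exact: prime_gt0.
Qed.

(** The isomorphism sends [x1^i f1(k)] to [x2^i f2(k)]. It respects products once [K] acts on both
    cyclic groups through the same exponents, and these need only be compared on generators of
    [K]. *)
Lemma sdprod_isog (K G1 G2 : finGroupType) (x1 : G1) (x2 : G2)
    (f1 : {morphism [set: K] >-> G1}) (f2 : {morphism [set: K] >-> G2})
    (r : nat) (s : r.-tuple K) (e : 'I_r -> nat) :
    <<[set x in s]>> = [set: K] -> #[x1] = #[x2] ->
    'injm f1 -> 'injm f2 ->
    <[x1]> ><| (f1 @* [set: K]) = [set: G1] ->
    <[x2]> ><| (f2 @* [set: K]) = [set: G2] ->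
    (forall k, x1 ^ f1 (tnth s k) = x1 ^+ e k) ->
    (forall k, x2 ^ f2 (tnth s k) = x2 ^+ e k) ->
  [set: G1] \isog [set: G2].
Proof.
move=> gen ox inj1 inj2 sd1 sd2 h1 h2.
have ox' : #[x2] %| #[x1] by rewrite ox.
pose fH := eltm_morphism ox'.
have fHE i : fH (x1 ^+ i) = x2 ^+ i by apply: eltmE.
have [_ _ n1 _] := sdprodP sd1.
have act k y : y \in <[x1]> -> fH (y ^ f1 k) = fH y ^ f2 k.
  have f1N k' : f1 k' \in 'N(<[x1]>).
    by apply: (subsetP n1); apply: mem_morphim; rewrite inE.
  (* The elements of [K] for which the two actions correspond form a subgroup, and it contains the
     generators. *)
  have grp : group_set [set k | [forall y in <[x1]>, fH (y ^ f1 k) == fH y ^ f2 k]].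
    apply/group_setP; split.
      by rewrite inE; apply/forall_inP=> z _; rewrite !morph1 !conjg1.
    move=> a b; rewrite !inE => /forall_inP ha /forall_inP hb.
    apply/forall_inP=> z z1; rewrite (morphM f1) ?inE // (morphM f2) ?inE // !conjgM.
    by rewrite (eqP (hb _ _)) ?memJ_norm // (eqP (ha _ z1)).
  have sub : <<[set k in s]>> \subset Group grp.
    rewrite gen_subG; apply/subsetP=> a; rewrite [a \in [set x in s]]inE => /tnthP[i ->].
    rewrite inE; apply/forall_inP=> _ /cycleP[j ->].
    rewrite (conjXg x1) h1 -expgM. by rewrite !fHE conjXg h2 -!expgM.
  have : k \in <<[set k in s]>> by rewrite gen inE.
  by move=> /(subsetP sub); rewrite inE => /forall_inP kP /kP/eqP.
pose fK := [morphism of f2 \o invm_morphism inj1].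
have dK : f1 @* [set: K] \subset 'dom fK.
  by apply/subsetP=> z z1; rewrite !inE z1 /=.
pose fK' := restrm_morphism dK fK.
have actf : {in <[x1]> & f1 @* [set: K], morph_act 'J 'J fH fK'}.
  move=> y z y1 /morphimP[k _ _ ->] /=; rewrite /restrm /= invmE ?inE //; exact: act.
pose F := sdprodm_morphism sd1 actf.
have imF : F @* [set: G1] = [set: G2].
  rewrite /F im_sdprodm im_eltm -(sdprodW sd2); congr (_ * _).
  rewrite /fK' morphim_restrm setIid morphim_comp im_invm //.
apply/isogP; exists F => //; rewrite -card_im_injm imF.
rewrite -(sdprod_card sd1) -(sdprod_card sd2) /= !card_injm //.
by rewrite -!orderE ox.
Qed.

(** A group of order [q * m] is coded by the isomorphism type of a complement of its normal Sylow
    q-subgroup, together with the exponents by which [r] generators of the complement act on that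
    cyclic subgroup. Modulo [q] each exponent is a root of unity of order dividing gcd(m, q - 1),
    which leaves at most that many choices. *)
Lemma gnu_peel q m r :
    prime q -> ~~ (q %| m) -> 0 < m ->
    (forall d, d %| m -> d %% q = 1 -> d = 1)%N ->
    (Omega m.+1 m <= r)%N ->
  (gnu (q * m) <= gnu m * gcdn m q.-1 ^ r)%N.
Proof.
move=> pq qm m0 hd hr; have [K [cardK _ exK]] := gnuP m.
have /fin_all_exists[s sP] i : exists s : r.-tuple (K i), <<[set x in s]>> = [set: K i].
  by apply: exists_generators; rewrite cardK.
pose A := [set u : 'F_q | (u ^+ gcdn m q.-1 == 1)%R].
pose F := ('I_(gnu m) * {ffun 'I_r -> {u : 'F_q | u \in A}})%type.
pose C (G : finGroupType) (c : F) := exists (x : G) (f : {morphism [set: K c.1] >-> G}),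
  [/\ #[x] = q, <[x]> ><| (f @* [set: K c.1]) = [set: G], 'injm f &
   forall k, x ^ f (tnth (s c.1) k) = x ^+ (val (c.2 k) : 'F_q)].
apply: (@leq_trans #|{: F}|); last first.
  rewrite card_prod card_ord card_ffun card_ord leq_mul2l leq_expn ?orbT //.
  by rewrite card_sig (leq_trans _ (card_Fp_roots q _)) ?gcdn_gt0 ?m0 // cardsE.
apply: (@gnu_le_code _ F C) => [G cardG|G H c].
  have [P [oP nP coP]] := normal_Sylow_prime pq cardG qm hd.
  have /splitsP[H /complP[tiPH defG]] : [splits [set: G], over P].
    by apply: SchurZassenhaus_split; rewrite // /Hall subsetT.
  have oH : #|[subg H]| = m.
    apply/eqP; rewrite -(card_isog (isog_subg H)) -(eqn_pmul2l (prime_gt0 pq)) -cardG.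
    by rewrite -{1}oP -TI_cardMg // defG cardsT.
  have cH : #|subg_of H| = m by rewrite -oH cardsT.
  have [i isoKi] := exK _ cH; have [f injf imf] := isogP (isog_symr isoKi).
  have [x defP] : exists x, P :=: <[x]>.
    by apply/cyclicP; apply: prime_cyclic; rewrite oP.
  have ox : #[x] = q by rewrite orderE -defP.
  have dh : [set: K i] \subset 'dom [morphism of sgval \o f].
    by apply/subsetP=> z _; rewrite !inE.
  pose h := restrm_morphism dh [morphism of sgval \o f].
  have injh : 'injm h by rewrite injm_restrm // injm_comp ?injm_sgval.
  have imh : h @* [set: K i] = H.
    by rewrite morphim_restrm setIid morphim_comp imf im_sgval.
  have ek k : {u : 'F_q | (u \in A) & x ^ h k = x ^+ u}.
    have : x ^ h k \in <[x]>.
      rewrite memJ_norm ?cycle_id // -defP; apply: (subsetP (normal_norm nP)).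
      by rewrite inE.
    case/cyclePmin=> e _ xe; exists (e%:R)%R; last first.
      by rewrite xe val_Fp_nat // -[in (e %% q)%N]ox expg_mod_order.
    have u0 : (e%:R != 0 :> 'F_q)%R.
      rewrite -(GRing.dvdn_pcharf (pchar_Fp pq)) -ox order_dvdn -xe.
      have : x != 1 by rewrite -order_gt1 ox prime_gt1.
      by rewrite conjg_eq1.
    rewrite inE; apply/eqP; apply: exp_gcdn => //.
      (* Conjugating [m] times by [h k] is trivial since [K i] has order [m], so [e^m = 1] modulo
         [q]; Fermat then supplies [e^(q-1) = 1]. *)
      have : x ^ (h k ^+ m) = x ^+ (e ^ m) by apply: conj_expg_iter.
      rewrite -morphX ?inE // -(cardK i) -cardsT expg_cardG ?inE // morph1 conjg1.
      move/eqP; rewrite -{1}[x]expg1 eq_expg_mod_order ox => /eqP e1.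
      by apply: val_inj; rewrite -GRing.natrX /= val_Fp_nat // -e1 modn_small ?prime_gt1.
    apply: (GRing.mulfI u0); rewrite -GRing.exprS prednK ?prime_gt0 // GRing.mulr1.
    by have := expf_card (e%:R : 'F_q)%R; rewrite (card_Fp pq).
  pose ec : {ffun 'I_r -> {u : 'F_q | u \in A}} :=
    [ffun k => exist _ (s2val (ek (tnth (s i) k))) (s2valP (ek (tnth (s i) k)))].
  exists (i, ec), x, h; split=> //=; last by move=> k; rewrite ffunE; apply: (s2valP' (ek _)).
  rewrite -[_ @* _]/(h @* _) imh -defP sdprodE //.
  by apply: subset_trans (normal_norm nP); apply: subsetT.
move=> [x [f [ox sd inj hk]]] [x' [f' [ox' sd' inj' hk']]].
apply: (sdprod_isog (sP c.1) _ inj inj' sd sd' hk hk').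
by rewrite ox ox'.
Qed.

End Peel.

(** * Counting groups of order satisfying the sieve conditions *)

(** [tau n.+1 n] is the full divisor function; a smaller cutoff [t] keeps only small divisors, whose
    average number is about log t. *)
Definition tau t n := \sum_(1 <= k < t) (k %| n).

Definition cubeless n := forall p, prime p -> ~~ (p ^ 3 %| n).

Lemma sum_nat_of_bool (I : Type) (r : seq I) (P : pred I) :
  \sum_(i <- r) P i = count P r.
Proof. by rewrite -sum1_count [RHS]big_mkcond; apply: eq_bigr => i _; case: (P i). Qed.

Lemma size_le_tau t n (s : seq nat) :
  uniq s -> {in s, forall k, 0 < k < t /\ k %| n} -> size s <= tau t n.
Proof.
move=> us hs; rewrite /tau sum_nat_of_bool -size_filter; apply: uniq_leq_size us _.
by move=> k /hs[kt kn]; rewrite mem_filter kn mem_index_iota.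
Qed.

Lemma sum_mem_le_size a b (s : seq nat) : \sum_(a <= k < b) (k \in s) <= size s.
Proof.
rewrite sum_nat_of_bool -size_filter; apply: uniq_leq_size.
  by rewrite filter_uniq // iota_uniq.
by move=> k; rewrite mem_filter => /andP[].
Qed.

Lemma logn_cubeless p n : cubeless n -> logn p n <= 2.
Proof.
move=> cn; rewrite leqNgt; apply/negP=> h.
have pp : prime p by move: h; rewrite lognE; case: prime.
have n0 : 0 < n by move: h; case: (n); rewrite ?logn0.
by have := cn _ pp; rewrite pfactor_dvdn // h.
Qed.

Lemma cubeless_dvd m n : m %| n -> cubeless n -> cubeless m.
Proof. by move=> mn cn p /cn; apply: contra => /dvdn_trans->. Qed.

Lemma cubeless_smooth_le t n : 0 < n -> cubeless n ->
  (forall p, prime p -> p %| n -> p <= t) -> n <= t ^ (2 * size (primes n)).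
Proof.
move=> n0 cn tn; rewrite [leqLHS]prod_prime_decomp // prime_decompE big_map /=.
have /= : all (fun p => 0 < p <= t) (primes n).
  by apply/allP=> p; rewrite mem_primes => /and3P[pp _ /tn->//]; rewrite prime_gt0.
elim: (primes n) => [|p s IH] /=; first by rewrite big_nil muln0.
case/andP=> /andP[p0 pt] /IH {}IH; rewrite big_cons mulnS expnD leq_mul //.
apply: leq_trans (leq_expn 2 pt); apply: leq_pexp2l => //; apply: logn_cubeless cn.
Qed.

Lemma prod_primes_dvd n : 0 < n -> \prod_(p <- primes n) p %| n.
Proof.
move=> n0; rewrite [X in _ %| X]prod_prime_decomp // prime_decompE big_map /= big_seq.
rewrite [X in _ %| X]big_seq; elim/big_ind2: _ => // [a b c d|p pn]; first exact: dvdn_mul.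
by rewrite dvdn_exp // logn_gt0.
Qed.

(** Adjoining [p] doubles the list of divisors: the old ones are not divisible by [p], the new ones
    are. Applied to the primes dividing [n], this bounds their number by the logarithm of the number
    of divisors. *)
Lemma subset_products (s : seq nat) : uniq s -> all prime s ->
  exists l : seq nat, [/\ uniq l, size l = 2 ^ size s &
    {in l, forall d, d %| \prod_(p <- s) p}].
Proof.
elim: s => [|p s IH] /=; first by exists [:: 1]; split=> // d; rewrite inE => /eqP->.
case/andP=> ps us /andP[pp prs]; have [l [ul sl dl]] := IH us prs.
have pN d : d \in l -> ~~ (p %| d).
  move=> /dl dd; apply: contra ps => /dvdn_trans/(_ dd); rewrite Euclid_dvd_prod //.
  rewrite big_has => /hasP[r rs]; rewrite dvdn_prime2 // ?(allP prs) //.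
  by move=> /eqP->.
exists (l ++ map (muln p) l); split.
- rewrite cat_uniq ul map_inj_uniq ?ul ?andbT.
    apply/hasP=> -[_ /mapP[d _ ->]] /pN; rewrite dvdn_mulr //.
  by move=> a b /eqP; rewrite eqn_mul2l (gtn_eqF (prime_gt0 pp)) => /eqP.
- by rewrite size_cat size_map sl addnn -mul2n expnS.
move=> d; rewrite big_cons mem_cat => /orP[/dl h|/mapP[e /dl h ->]].
  by rewrite dvdn_mull.
by rewrite dvdn_mul.
Qed.

Lemma exp2_omega_le_tau n : 0 < n -> 2 ^ size (primes n) <= tau n.+1 n.
Proof.
move=> n0; have ap : all prime (primes n).
  by apply/allP=> p; rewrite mem_primes => /and3P[].
have [l [ul <- dl]] := subset_products (primes_uniq n) ap.
apply: size_le_tau ul _ => k /dl h; have kn := dvdn_trans h (prod_primes_dvd n0).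
by split=> //; rewrite ltnS (dvdn_leq n0 kn) (dvdn_gt0 n0 kn).
Qed.

(** * Iterated logarithms and the sieve conditions *)

Definition ilog k n := iter k (trunc_log 2) n.

Lemma ilogS_gt0 k n : 0 < ilog k.+1 n -> 0 < ilog k n /\ 2 ^ ilog k.+1 n <= ilog k n.
Proof.
rewrite /= trunc_log_gt0 /= => h; have h0 : 0 < ilog k n by apply: ltnW.
by split=> //; apply: trunc_logP.
Qed.

Lemma ilogS_le k n : ilog k.+1 n <= ilog k n.
Proof.
have [->//|/ilogS_gt0[_ h]] := posnP (ilog k.+1 n).
by apply: leq_trans h; apply/ltnW/ltn_expl.
Qed.

(* J n = ilog 6 n is an iterated logarithm growing so slowly that the 4^J n-smooth part
   of n is at most log log n, and groups of that order may be counted trivially. *)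
Definition good n := forall j, ilog 6 n <= j <= ilog 1 n ->
  4 * j.+1 * tau (4 ^ j.+1) n <= 2 ^ j /\
  forall q, 4 ^ j <= q < 4 ^ j.+1 -> ~~ (q * q %| n) /\
    forall k, 1 <= k < 2 ^ 2 ^ j -> ~~ (q * (k * q + 1) %| n).

Lemma linear_le_exp2 k : 4 <= k -> 3 * k + 2 <= 2 ^ k.
Proof.
elim: k => // k IH; rewrite leq_eqVlt => /orP[/eqP[<-] //|k4]; have := IH k4; rewrite expnS; lia.
Qed.

(** The 4^J-smooth part of a cubeless [n] is at most [2^(4 J 4^J)], hence at most [ilog 2 n] by this
    tower. Six logarithms leave enough room: [4 J 4^J <= 2^(3J+2)] and [3J+2 <= 2^J <= ilog 5 n]. *)
Lemma ilog_tower n (J := ilog 6 n) : 10 <= J ->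
  [/\ 4 * J * 4 ^ J <= ilog 3 n, 2 ^ ilog 3 n <= ilog 2 n & 1000 <= ilog 2 n].
Proof.
move=> Jn.
have [h5 J5] : 0 < ilog 5 n /\ 2 ^ J <= ilog 5 n by apply: ilogS_gt0; apply: leq_trans Jn.
have [h4 J4] := ilogS_gt0 h5; have [h3 J3] := ilogS_gt0 h4.
have [h2 J2] := ilogS_gt0 h3.
have l5 : 1024 <= ilog 5 n by apply: leq_trans J5; rewrite -[1024]/(2 ^ 10) leq_exp2l.
split=> //; last first.
  apply: leq_trans (ilogS_le 2 n); apply: leq_trans (ilogS_le 3 n).
  by apply: leq_trans (ilogS_le 4 n); apply: leq_trans l5.
apply: leq_trans J3; apply: (@leq_trans (2 ^ (3 * J + 2))).
  have -> : 2 ^ (3 * J + 2) = 4 * 2 ^ J * 4 ^ J.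
    by rewrite (_ : 4 = 2 ^ 2) // -expnM -!expnD; congr expn; lia.
  by rewrite leq_mul2r leq_mul2l (ltnW (ltn_expl _ _)) ?orbT.
rewrite leq_exp2l //; apply: (@leq_trans (2 ^ J)); last first.
  by apply: leq_trans J5 (ilogS_le 4 n).
by apply: linear_le_exp2; apply: leq_trans Jn.
Qed.

(** * Peeling the large primes off an order that satisfies the sieve conditions *)

Section MainBound.
Variable n : nat.
Hypotheses (n0 : 0 < n) (cn : cubeless n) (gn : good n).

Let J := ilog 6 n.
Let lam := ilog 2 n.
Let omega := size (primes n).

Let part t := n`_[pred p | p < t].

Lemma size_primes_dvd d : d %| n -> size (primes d) <= omega.
Proof.
move=> dn; apply: uniq_leq_size (primes_uniq d) _ => p.
by rewrite !mem_primes n0 => /and3P[-> _ /dvdn_trans->].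
Qed.

Lemma Omega_dvd N d : d %| n -> Omega N d <= 2 * omega.
Proof.
move=> dn; apply: leq_trans (_ : \sum_(0 <= p < N) 2 * (p \in primes n) <= _).
  apply: leq_sum => p _; case: (boolP (p \in primes n)) => pn.
    by rewrite /= muln1 logn_cubeless //; apply: cubeless_dvd cn.
  rewrite /= muln0 leqNgt logn_gt0; apply: contra pn.
  by rewrite !mem_primes n0 => /and3P[-> _ /dvdn_trans->].
by rewrite -big_distrr /= leq_mul2l sum_mem_le_size.
Qed.

Lemma part_size t : size (primes (part t)) <= tau t n.
Proof.
rewrite primes_part; apply: size_le_tau; first by rewrite filter_uniq ?primes_uniq.
by move=> p; rewrite mem_filter mem_primes => /and4P[/= pt pp _ pn]; rewrite prime_gt0.
Qed.

Lemma part_le t : part t <= t ^ (2 * size (primes (part t))).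
Proof.
apply: cubeless_smooth_le; rewrite ?part_gt0 //.
  by apply: cubeless_dvd cn; apply: dvdn_part.
move=> p pp pd; have : p \in primes (part t) by rewrite mem_primes pp part_gt0.
by rewrite primes_part mem_filter /= => /andP[/ltnW].
Qed.

Lemma block_of q : 4 ^ J <= q <= n ->
  exists2 j, J <= j <= ilog 1 n & 4 ^ j <= q < 4 ^ j.+1.
Proof.
case/andP=> Jq qn; have q0 : 0 < q by apply: leq_trans Jq; rewrite expn_gt0.
exists (trunc_log 4 q).
  rewrite trunc_log_max //=; apply: trunc_log_max => //.
  apply: leq_trans qn; apply: leq_trans (trunc_logP (isT : 1 < 4) q0).
  exact: leq_expn.
by apply: trunc_log_bounds.
Qed.

Lemma part_succ q : prime q -> q %| n -> ~~ (q * q %| n) -> part q.+1 = q * part q.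
Proof.
move=> pq qn qqn; have q0 := prime_gt0 pq.
rewrite /part /partn big_mkcond (bigD1_seq q) ?iota_uniq //=; last first.
  by rewrite mem_index_iota /= ltnS; apply: dvdn_leq.
rewrite inE ltnSn; congr (_ * _); last first.
  rewrite [LHS]big_mkcond [RHS]big_mkcond; apply: eq_bigr => p _.
  by rewrite !inE ltnS ltn_neqAle; case: eqP.
suff -> : logn q n = 1 by rewrite expn1.
apply/eqP; rewrite eqn_leq logn_gt0 mem_primes pq n0 qn andbT.
by rewrite leqNgt -pfactor_dvdn // -mulnn qqn.
Qed.

Lemma part_succ_eq t : t \notin primes n -> part t.+1 = part t.
Proof.
move=> tn; apply: eq_in_partn => p pn; rewrite !inE ltnS leq_eqVlt.
by have [pt|] //= := eqVneq p t; move: tn; rewrite -pt pn.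
Qed.

(** Write [d = k q + 1] with [k > 0]. If [k < 2^(2^j)], the sieve condition excludes [q d] dividing
    [n]. Otherwise [d > 2^(2^j)], although [d] divides the q-smooth part of [n], which is at most
    [q^(2 tau) <= 2^(4 (j+1) tau) <= 2^(2^j)]. *)
Lemma Sylow_condition q d : prime q -> q %| n -> 4 ^ J <= q ->
  d %| part q -> d %% q = 1 -> d = 1.
Proof.
move=> pq qn Jq dp dq; have d_n : d %| n by apply: dvdn_trans dp (dvdn_part _ _).
have [j jJ jq] : exists2 j, J <= j <= ilog 1 n & 4 ^ j <= q < 4 ^ j.+1.
  by apply: block_of; rewrite Jq dvdn_leq.
have [tauj /(_ q jq)[_ gj]] := gn jJ.
have de := divn_eq d q; rewrite dq in de; move: de; set k := d %/ q => de.
have [k0|k0] := posnP k; first by rewrite de k0.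
have [klt|kge] := ltnP k (2 ^ 2 ^ j).
  have := gj k; rewrite k0 klt -de => /(_ isT)/negP[].
  by rewrite Gauss_dvd ?qn // prime_coprime // /dvdn dq.
have : d <= 2 ^ 2 ^ j.
  apply: leq_trans (dvdn_leq (part_gt0 _ _) dp) _.
  apply: leq_trans (part_le q) _; case/andP: jq => _ jq.
  apply: leq_trans (leq_expn _ (ltnW jq)) _.
  rewrite -expnM (_ : 4 = 2 ^ 2) // -expnM leq_exp2l //.
  have : size (primes (part q)) <= tau (4 ^ j.+1) n.
    apply: leq_trans (part_size q) _; rewrite /tau.
    by rewrite [leqRHS](@big_cat_nat _ _ _ q) /= ?leq_addr ?prime_gt0 // ltnW.
  by move=> h; apply: leq_trans tauj; move: h; set s := size _; set u := tau _ _; nia.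
move=> dle; exfalso; have := leq_trans dle kge; have := prime_gt1 pq; nia.
Qed.

(** A prime [p > 4^(lam+1)] dividing both [q - 1] and [n] would give [q = k p + 1] with [p q]
    dividing [n]. The sieve condition for the block of [p] excludes this: there [j > lam], so
    [k < q <= n < 2^(2^j)]. *)
Lemma gcd_bound q m : prime q -> q %| n -> m %| n ->
  gcdn m q.-1 <= (4 ^ lam.+1) ^ (2 * omega).
Proof.
move=> pq qn mn; set g := gcdn _ _; have gn' : g %| n by apply: dvdn_trans (dvdn_gcdl _ _) mn.
apply: leq_trans (_ : (4 ^ lam.+1) ^ (2 * size (primes g)) <= _).
  apply: cubeless_smooth_le => [||p pp pg].
  - exact: dvdn_gt0 gn'.
  - exact: cubeless_dvd cn.
  have pn := dvdn_trans pg gn'; rewrite leqNgt; apply/negP=> lp.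
  have lamJ : J <= lam.+1.
    by rewrite leqW // (leq_trans (ilogS_le 5 n)) // (leq_trans (ilogS_le 4 n)) //
      (leq_trans (ilogS_le 3 n)) // ilogS_le.
  have [j jJ jp] : exists2 j, J <= j <= ilog 1 n & 4 ^ j <= p < 4 ^ j.+1.
    apply: block_of; rewrite (dvdn_leq n0 pn) andbT.
    by apply: leq_trans (ltnW lp); rewrite leq_exp2l.
  have [_ /(_ p jp)[_ gj]] := gn jJ.
  have lamj : lam < j.
    by case/andP: jp => _ jp; have := ltn_trans lp jp; rewrite ltn_exp2l // ltnS.
  have [k qk] : exists k, q = k * p + 1.
    have : p %| q.-1 by apply: dvdn_trans pg (dvdn_gcdr _ _).
    by case/dvdnP=> k qk; exists k; rewrite -qk addn1 prednK ?prime_gt0.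
  have k0 : 0 < k by case: (k) qk pq => // ->.
  have kq : k < q by rewrite qk addn1 ltnS leq_pmulr ?prime_gt0.
  have pq' : p < q by rewrite qk addn1 ltnS leq_pmull.
  have := gj k; rewrite k0 -qk Gauss_dvd ?pn ?qn; last first.
    by rewrite prime_coprime // dvdn_prime2 // ltn_eqF.
  have -> : k < 2 ^ 2 ^ j.
    apply: leq_trans kq _; apply: leq_trans (dvdn_leq n0 qn) _.
    apply: leq_trans (ltnW (trunc_log_ltn n (isT : 1 < 2))) _; rewrite leq_exp2l //.
    apply: leq_trans (trunc_log_ltn (ilog 1 n) (isT : 1 < 2)) _; rewrite leq_exp2l //.
  by move=> /(_ isT).
by rewrite leq_pexp2l ?expn_gt0 // leq_mul2l size_primes_dvd.
Qed.


(** Each prime [q >= 4^J] dividing [n] costs one application of [gnu_peel] with [2 omega]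
    generators; any other integer leaves [part] unchanged. *)
Lemma gnu_part_le t :
  gnu (part (4 ^ J + t)) <= gnu (part (4 ^ J)) *
    (((4 ^ lam.+1) ^ (2 * omega)) ^ (2 * omega)) ^
      \sum_(4 ^ J <= p < 4 ^ J + t) (p \in primes n).
Proof.
elim: t => [|t IH]; first by rewrite addn0 big_geq // muln1.
set q := 4 ^ J + t in IH *.
have Jq : 4 ^ J <= q by rewrite leq_addr.
rewrite addnS big_nat_recr //= expnD mulnA.
case: (boolP (q \in primes n)) => qn; last by rewrite part_succ_eq // muln1.
move: (qn); rewrite mem_primes => /and3P[pq _ q_n].
have [j jJ jq] : exists2 j, J <= j <= ilog 1 n & 4 ^ j <= q < 4 ^ j.+1.
  by apply: block_of; rewrite Jq dvdn_leq.
have [_ /(_ q jq)[qq _]] := gn jJ.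
rewrite (part_succ pq q_n qq) expn1.
have pn : part q %| n by apply: dvdn_part.
apply: leq_trans (_ : gnu (part q) * gcdn (part q) q.-1 ^ (2 * omega) <= _).
  apply: gnu_peel; rewrite ?part_gt0 //; last exact: Omega_dvd.
    apply/negP=> qp; have : q \in primes (part q) by rewrite mem_primes pq part_gt0.
    by rewrite primes_part mem_filter inE ltnn.
  by move=> d; apply: Sylow_condition.
by rewrite leq_mul //; apply/leq_expn/gcd_bound.
Qed.

Hypothesis Jn : 10 <= J.

Lemma small_part_le : part (4 ^ J) <= lam.
Proof.
have [h3 h2 _] := ilog_tower Jn; apply: leq_trans h2; apply: leq_trans (part_le _) _.
apply: (@leq_trans ((4 ^ J) ^ (2 * 4 ^ J))).
  rewrite leq_pexp2l ?expn_gt0 // leq_mul2l (leq_trans (part_size _)) // /tau.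
  rewrite sum_nat_of_bool (leq_trans (count_size _ _)) // size_iota; exact: leq_subr.
have -> : ((4 ^ J) ^ (2 * 4 ^ J)) = 2 ^ (4 * J * 4 ^ J).
  by rewrite -expnM (_ : 4 ^ (J * (2 * 4 ^ J)) = (2 ^ 2) ^ (J * (2 * 4 ^ J))) // -expnM; congr expn; lia.
by rewrite leq_exp2l.
Qed.

Hypothesis wn : tau n.+1 n <= (ilog 1 n).+1 ^ 3.

Lemma omega_le : omega <= 3 * lam.+1.
Proof.
rewrite -(leq_exp2l (m := 2)) //; apply: leq_trans (exp2_omega_le_tau n0) _.
apply: leq_trans wn _; rewrite mulnC expnM; apply: leq_expn.
exact: trunc_log_ltn.
Qed.

Lemma gnu_le_main : gnu n <= 2 ^ (lam ^ 6).
Proof.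
have [_ _ lam0] := ilog_tower Jn; rewrite -/lam in lam0; have wl := omega_le.
have partn : gnu n <= gnu (part (4 ^ J)) *
    (((4 ^ lam.+1) ^ (2 * omega)) ^ (2 * omega)) ^ omega.
  have [t nt] : exists t, n < 4 ^ J + t by exists n; rewrite -add1n leq_add2r expn_gt0.
  rewrite -[X in gnu X](_ : part (4 ^ J + t) = n); last first.
    rewrite -[RHS]partnT //; apply: eq_in_partn => p; rewrite mem_primes => /and3P[_ _ pn].
    by rewrite !inE (leq_ltn_trans _ nt) // dvdn_leq.
  apply: leq_trans (gnu_part_le t) _; rewrite leq_mul2l leq_pexp2l ?orbT //.
    by rewrite !expn_gt0.
  exact: sum_mem_le_size.
apply: leq_trans partn _.
(* The first factor counts multiplication tables of order at most [lam]. The second comes from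
   peeling, whose exponent is [8 (lam+1) omega^3] with [omega <= 3 (lam+1)]. *)
apply: (@leq_trans (2 ^ (lam ^ 3) * 2 ^ (216 * lam.+1 ^ 4))).
  apply: leq_mul; last first.
    rewrite (_ : 4 = 2 ^ 2) // -!expnM leq_exp2l //.
    apply: (@leq_trans (8 * lam.+1 * (omega * omega * omega))); first by lia.
    apply: (@leq_trans (8 * lam.+1 * ((3 * lam.+1) * (3 * lam.+1) * (3 * lam.+1)))).
      by rewrite leq_mul2l !leq_mul ?orbT.
    by rewrite !expnS expn0; lia.
  apply: leq_trans (gnu_le_tables _) _.
  apply: (@leq_trans (lam ^ (lam * lam))).
    apply: leq_trans (leq_expn _ small_part_le) _.
    by rewrite leq_pexp2l ?(leq_trans _ lam0) // leq_mul // small_part_le.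
  apply: leq_trans (leq_expn _ (ltnW (ltn_expl lam (isT : 1 < 2)))) _.
  by rewrite -expnM leq_exp2l // !expnS expn0; lia.
rewrite -expnD leq_exp2l //.
have : lam.+1 <= 2 * lam by lia.
move=> h; apply: (@leq_trans (lam ^ 3 + 216 * (2 * lam) ^ 4)).
  by rewrite leq_add2l leq_mul2l leq_expn.
rewrite expnMn (expnD lam 3 3 : lam ^ 6 = _) (expnSr lam 3).
have : 1000 * 1000 <= lam * lam by apply: leq_mul.
have : lam * lam * lam <= lam ^ 3 by rewrite !expnS expn0; lia.
move: lam0 (lam ^ 3); clear; move: lam => l l0 x lx l2.
have : 1000 * (l * l) <= x by apply: leq_trans lx; rewrite -mulnA leq_mul.
have -> : 2 ^ 4 = 16 by [].
nia.
Qed.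

End MainBound.

From mathcomp Require Import all_classical all_reals all_analysis.
From mathcomp Require Import ring lra.
Import Order.TTheory GRing.Theory Num.Theory.
Import numFieldNormedType.Exports.
Local Open Scope classical_set_scope.
Local Open Scope ring_scope.

(** * Density of the sieve conditions *)

Section Counting.
Variable R : realType.

Lemma sum_inv_block (a e : nat) :
  \sum_(2 ^ a <= k < 2 ^ (a + e)) (k%:R : R)^-1 <= e%:R.
Proof.
elim: e => [|e IH]; first by rewrite addn0 big_geq.
rewrite addnS expnS (@big_cat_nat _ _ _ (2 ^ (a + e))) /=; last first.
- by rewrite leq_pmull.
- by rewrite leq_exp2l // leq_addr.
rewrite -natr1 lerD //.
apply: (@le_trans _ _ (\sum_(2 ^ (a + e) <= k < 2 * 2 ^ (a + e)) ((2 ^ (a + e))%:R : R)^-1)).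
  rewrite big_nat_cond [leRHS]big_nat_cond; apply: ler_sum => k /andP[/andP[k1 _] _].
  by rewrite lef_pV2 ?posrE ?ltr0n ?expn_gt0 // ?ler_nat // (leq_trans _ k1) ?expn_gt0.
by rewrite sumr_const_nat mul2n -addnn addnK -[_ *+ _]mulr_natr mulVf //.
Qed.

Lemma harmonic_le (t e : nat) : (t <= 2 ^ e)%N ->
  \sum_(1 <= k < t) (k%:R : R)^-1 <= e%:R.
Proof.
move=> te; apply: le_trans (sum_inv_block 0 e); rewrite expn0 add0n.
have [t1|t1] := leqP t 1; first by rewrite big_geq // sumr_ge0.
rewrite [leRHS](@big_cat_nat _ _ _ t) /= ?lerDl ?sumr_ge0 // ltnW //.
Qed.

Lemma sum_dvd_le (m x : nat) : (0 < m)%N ->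
  ((\sum_(1 <= n < x.+1) (m %| n)%N)%N)%:R <= x%:R / m%:R :> R.
Proof.
move=> m0; rewrite -divn_count_dvd ler_pdivlMr ?ltr0n // -natrM ler_nat.
exact: leq_trunc_div.
Qed.

Lemma sum_tau_le (t e x : nat) : (t <= 2 ^ e)%N ->
  ((\sum_(1 <= n < x.+1) tau t n)%N)%:R <= x%:R * e%:R :> R.
Proof.
move=> te; rewrite /tau exchange_big /= natr_sum.
apply: (@le_trans _ _ (\sum_(1 <= k < t) x%:R / k%:R)).
  rewrite big_nat_cond [leRHS]big_nat_cond.
  by apply: ler_sum => k /andP[/andP[k1 _] _]; apply: sum_dvd_le.
by rewrite -mulr_sumr ler_wpM2l ?harmonic_le.
Qed.

(** These detect the failures of [good] in block [j], the divisor condition by an indicator and the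
    other two by counting offending [q] and pairs [q], [k]; being numbers, they can be averaged over
    [n]. *)
Definition badE j n : nat := ~~ (4 * j.+1 * tau (4 ^ j.+1) n <= 2 ^ j)%N.
Definition cntQ j n : nat := (\sum_(4 ^ j <= q < 4 ^ j.+1) (q * q %| n))%N.
Definition cntF j n : nat :=
  (\sum_(4 ^ j <= q < 4 ^ j.+1) \sum_(1 <= k < 2 ^ 2 ^ j) (q * (k * q + 1) %| n))%N.

(** Markov's inequality: the average of [tau (4^(j+1))] is at most the binary logarithm [2 (j+1)] of
    its cutoff. *)
Lemma sum_badE (j x : nat) :
  ((\sum_(1 <= n < x.+1) badE j n)%N)%:R <= x%:R * (8 * (j.+1)%:R ^+ 2) / 2 ^+ j :> R.
Proof.
rewrite ler_pdivlMr ?exprn_gt0 // -natrX -natrM.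
have h : ((\sum_(1 <= n < x.+1) badE j n) * 2 ^ j <=
          4 * j.+1 * \sum_(1 <= n < x.+1) tau (4 ^ j.+1) n)%N.
  rewrite big_distrl big_distrr /=; apply: leq_sum => n _; rewrite /badE.
  by case: (leqP (4 * j.+1 * tau _ n)%N (2 ^ j)%N) => h; rewrite /= ?mul0n // mul1n ltnW.
apply: (@le_trans _ _ ((4 * j.+1 * \sum_(1 <= n < x.+1) tau (4 ^ j.+1) n)%N)%:R).
  by rewrite ler_nat.
rewrite natrM; apply: (@le_trans _ _ ((4 * j.+1)%:R * (x%:R * (2 * j.+1)%:R))).
  by rewrite ler_wpM2l // sum_tau_le // expnM.
by rewrite !natrM; set y := j.+1%:R; rewrite le_eqVlt; apply/orP; left; apply/eqP; ring.
Qed.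

Lemma sum_inv_sq_block (j : nat) :
  \sum_(4 ^ j <= q < 4 ^ j.+1) ((q * q)%:R : R)^-1 <= 4 / 4 ^+ j.
Proof.
have p0 : 0 < 4 ^+ j :> R by rewrite exprn_gt0.
apply: (@le_trans _ _ (\sum_(4 ^ j <= q < 4 ^ j.+1) (4 ^+ j * 4 ^+ j)^-1)).
  rewrite big_nat_cond [leRHS]big_nat_cond; apply: ler_sum => q /andP[/andP[q1 _] _].
  have q1' : 4 ^+ j <= q%:R :> R by rewrite -natrX ler_nat.
  rewrite lef_pV2 ?posrE ?mulr_gt0 // natrM ?mulr_gt0 ?(lt_le_trans p0) //.
  by rewrite ler_pM // ltW.
rewrite sumr_const_nat -[_ *+ _]mulr_natr invfM -mulrA.
rewrite [leLHS]mulrC -[leRHS]mulrC; rewrite [leRHS]mulrC.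
by rewrite ler_pM2r ?invr_gt0 // mulrC ler_pdivrMr // -exprS -natrX ler_nat leq_subr.
Qed.

Lemma sum_cntQ (j x : nat) :
  ((\sum_(1 <= n < x.+1) cntQ j n)%N)%:R <= x%:R * (4 / 4 ^+ j) :> R.
Proof.
rewrite /cntQ exchange_big /= natr_sum.
apply: (@le_trans _ _ (\sum_(4 ^ j <= q < 4 ^ j.+1) x%:R / (q * q)%:R)).
  rewrite big_nat_cond [leRHS]big_nat_cond.
  apply: ler_sum => q /andP[/andP[q1 _] _]; apply: sum_dvd_le.
  by rewrite muln_gt0 andbb (leq_trans _ q1) // expn_gt0.
by rewrite -mulr_sumr ler_wpM2l ?sum_inv_sq_block.
Qed.

(** Since [q (k q + 1) >= k q^2], the sum over [k] is harmonic and at most [2^j], while [1/q^2] sums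
    to at most [4 / 4^j] over the block. *)
Lemma sum_cntF (j x : nat) :
  ((\sum_(1 <= n < x.+1) cntF j n)%N)%:R <= x%:R * (4 / 4 ^+ j * 2 ^+ j) :> R.
Proof.
rewrite /cntF exchange_big /= natr_sum.
apply: (@le_trans _ _ (\sum_(4 ^ j <= q < 4 ^ j.+1) (x%:R / (q * q)%:R * 2 ^+ j))).
  rewrite big_nat_cond [leRHS]big_nat_cond.
  apply: ler_sum => q /andP[/andP[q1 _] _].
  have q0 : (0 < q)%N by rewrite (leq_trans _ q1) // expn_gt0.
  rewrite exchange_big /= natr_sum.
  apply: (@le_trans _ _ (\sum_(1 <= k < 2 ^ 2 ^ j) x%:R / (q * q)%:R * k%:R^-1)).
    rewrite big_nat_cond [leRHS]big_nat_cond.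
    apply: ler_sum => k /andP[/andP[k1 _] _].
    apply: le_trans (sum_dvd_le _ _) _; first by rewrite muln_gt0 q0 addn1.
    rewrite -mulrA -invfM -natrM ler_wpM2l // lef_pV2 ?posrE ?ltr0n ?muln_gt0 ?q0 ?k1 ?addn1 //.
    by rewrite ler_nat; nia.
  rewrite -mulr_sumr ler_wpM2l ?mulr_ge0 ?invr_ge0 // -natrX.
  exact: harmonic_le.
rewrite -mulr_suml -mulr_sumr mulrA ler_wpM2r ?exprn_ge0 // ler_wpM2l //.
exact: sum_inv_sq_block.
Qed.

(** This absorbs quadratic factors, so that block errors become geometric of ratio 3/4. The
    polynomial dominates the [8 (j+1)^2 + 8] that arises and lets the induction close. *)
Lemma quad_le_geom (j : nat) :
  8 * (j%:R : R) ^+ 2 + 20 * j%:R + 64 <= 64 * (3 / 2) ^+ j.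
Proof.
elim: j => [|j IH]; first by rewrite expr0; lra.
(* The step needs [4 y^2 - 6 y + 4 >= 0], and the left side is a quarter of [(4 y - 3)^2 + 7]. *)
rewrite -[j.+1%:R]natr1 [(3 / 2) ^+ _]exprS; move: IH; move: (j%:R : R) ((3 / 2) ^+ j) => y E IH; have := sqr_ge0 (4 * y - 3); nra.
Qed.

Lemma block_le (j x : nat) :
  ((\sum_(1 <= n < x.+1) (badE j n + cntQ j n + cntF j n))%N)%:R
    <= x%:R * (64 * (3 / 4) ^+ j) :> R.
Proof.
rewrite !big_split /= !natrD.
apply: le_trans (lerD (lerD (sum_badE j x) (sum_cntQ j x)) (sum_cntF j x)) _.
have e4 : 4 ^+ j = 2 ^+ j * 2 ^+ j :> R by rewrite -exprMn; congr (_ ^+ _); lra.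
have -> : (3 / 4) ^+ j = (3 / 2) ^+ j / 2 ^+ j :> R.
  by rewrite -expr_div_n; congr (_ ^+ _); lra.
have q := quad_le_geom j; rewrite e4.
have p1 : 1 <= 2 ^+ j :> R by rewrite exprn_ege1 // ler1n.
have p0 : 0 < 2 ^+ j :> R by apply: lt_le_trans p1.
set p := 2 ^+ j in p1 p0 *.
have -> : x%:R * (8 * j.+1%:R ^+ 2) / p + x%:R * (4 / (p * p)) + x%:R * (4 / (p * p) * p)
   = x%:R * ((8 * j.+1%:R ^+ 2 + 4 / p + 4) / p) by field; rewrite gt_eqF.
rewrite (mulrA 64) ler_wpM2l // ler_pM2r ?invr_gt0 //; apply: le_trans q.
have : 4 / p <= 4 by rewrite ler_pdivrMr //; lra.
rewrite -[j.+1%:R]natr1; have : (0 : R) <= j%:R by []; nra.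
Qed.

Lemma geom_tail (a b : nat) : \sum_(a <= j < b) (3 / 4 : R) ^+ j <= 4 * (3 / 4) ^+ a.
Proof.
have [ba|ab] := leqP b a; first by rewrite big_geq // mulr_ge0 // exprn_ge0 //; lra.
pose F j : R := - (4 * (3 / 4) ^+ j).
have -> : \sum_(a <= j < b) (3 / 4 : R) ^+ j = F b - F a.
  rewrite -telescope_sumr 1?ltnW //.
  by apply: eq_bigr => j _; rewrite /F exprS; lra.
have : 0 <= (3 / 4 : R) ^+ b by rewrite exprn_ge0 //; lra.
rewrite /F; lra.
Qed.

(** Both cutoffs are uniform in [n]: for [s <= n <= x], bounding all divisors up to [x] by the
    threshold at [s] implies the bound required in [typical]. *)
Definition badW s x n : nat := ~~ (tau x.+1 n <= (ilog 1 s).+1 ^ 3)%N.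

Lemma sum_badW (s x : nat) :
  ((\sum_(1 <= n < x.+1) badW s x n)%N)%:R
    <= x%:R * ((ilog 1 x).+1%:R / (ilog 1 s).+1%:R ^+ 3) :> R.
Proof.
rewrite mulrA ler_pdivlMr ?exprn_gt0 // -natrX -[leLHS]natrM.
have h : ((\sum_(1 <= n < x.+1) badW s x n) * (ilog 1 s).+1 ^ 3 <=
          \sum_(1 <= n < x.+1) tau x.+1 n)%N.
  rewrite big_distrl /=; apply: leq_sum => n _; rewrite /badW.
  by case: (leqP (tau _ n)) => h; rewrite /= ?mul0n // mul1n ltnW.
apply: (@le_trans _ _ ((\sum_(1 <= n < x.+1) tau x.+1 n)%N)%:R); first by rewrite ler_nat.
by apply: sum_tau_le; apply: trunc_log_ltn.
Qed.

End Counting.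

(** This is the set [T] of the theorem; the last condition drops finitely many integers and
    validates the numerical estimates. *)
Definition typical : set nat := [set n | [/\ cubefree n, good n,
  (tau n.+1 n <= (ilog 1 n).+1 ^ 3)%N & (10 <= ilog 6 n)%N]].

Lemma leq_ilog k m n : (m <= n)%N -> (ilog k m <= ilog k n)%N.
Proof. by move=> mn; elim: k => //= k IH; apply: leq_trunc_log. Qed.

Lemma atypical_le (s x n : nat) : (0 < n <= x)%N -> (10 <= ilog 6 s)%N ->
  (((n \in cubefree) : nat) <= (n \in typical) + ((n < s) + badW s x n +
    \sum_(ilog 6 s <= j < (ilog 1 x).+1) (badE j n + cntQ j n + cntF j n)))%N.
Proof.
case/andP=> n0 nx Js; case: (boolP (n \in cubefree)) => // /set_mem cn.
have [typ|atyp] := boolP (n \in typical); first by rewrite leq_addr.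
rewrite lt0n; apply: contra atyp.
rewrite !addn_eq0 => /andP[_ /andP[/andP[ns bW] bs]].
have {}ns : (s <= n)%N by move: ns; rewrite eqb0 -leqNgt.
apply/mem_set; split => //.
- move=> j /andP[j1 j2].
  have : badE j n + cntQ j n + cntF j n == 0%N.
    move: bs; rewrite sum_nat_seq_eq0 => /allP/(_ j); apply.
    by rewrite mem_index_iota (leq_trans (leq_ilog 6 ns)) //= ltnS (leq_trans j2) // leq_ilog.
  rewrite !addn_eq0 => /andP[/andP[bE bQ] bF]; split.
    by move: bE; rewrite eqb0 negbK.
  move=> q jq; split.
    move: bQ; rewrite sum_nat_seq_eq0 => /allP/(_ q); rewrite mem_index_iota jq => /(_ isT).
    by rewrite eqb0.
  move=> k kj; move: bF; rewrite sum_nat_seq_eq0 => /allP/(_ q).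
  rewrite mem_index_iota jq => /(_ isT); rewrite sum_nat_seq_eq0 => /allP/(_ k).
  by rewrite mem_index_iota kj => /(_ isT); rewrite eqb0.
- move: bW; rewrite eqb0 negbK => h.
  apply: (@leq_trans (tau x.+1 n)).
    by rewrite /tau [leqRHS](@big_cat_nat _ _ _ n.+1) ?leq_addr.
  by apply: leq_trans h _; apply: leq_expn; rewrite ltnS leq_ilog.
- exact: leq_trans (leq_ilog 6 ns).
Qed.

Lemma count_atypical_le (R : realType) (s x : nat) : (10 <= ilog 6 s)%N ->
  (count_upto cubefree x)%:R <= (count_upto typical x)%:R + (s%:R +
   x%:R * ((ilog 1 x).+1%:R / (ilog 1 s).+1%:R ^+ 3 + 256 * (3 / 4) ^+ ilog 6 s)) :> R.
Proof.
move=> Js; rewrite /count_upto.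
have h : (\sum_(1 <= k < x.+1) (k \in cubefree) <=
    \sum_(1 <= k < x.+1) (k \in typical) + (\sum_(1 <= k < x.+1) (k < s) +
    \sum_(1 <= n < x.+1) badW s x n +
    \sum_(ilog 6 s <= j < (ilog 1 x).+1) \sum_(1 <= n < x.+1)
      (badE j n + cntQ j n + cntF j n)))%N.
  rewrite [in X in (_ <= X)%N]exchange_big -!big_split /=.
  rewrite big_nat_cond [leqRHS]big_nat_cond; apply: leq_sum => n /andP[nx _].
  exact: atypical_le.
apply: (@le_trans _ _ (_%:R)); first by rewrite ler_nat; exact: h.
rewrite natrD lerD2l natrD mulrDr addrA lerD // ?natrD ?lerD ?ler_nat ?sum_badW //.
  rewrite sum_nat_of_bool -size_filter.
  apply: leq_trans (_ : size (iota 0 s) <= _)%N; last by rewrite size_iota.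
  apply: uniq_leq_size; first by rewrite filter_uniq // iota_uniq.
  by move=> k; rewrite mem_filter mem_iota add0n => /andP[-> _].
rewrite natr_sum; apply: (@le_trans _ _ (\sum_(ilog 6 s <= j < (ilog 1 x).+1)
   x%:R * (64 * (3 / 4) ^+ j))); first by apply: ler_sum => j _; apply: block_le.
rewrite -!mulr_sumr ler_wpM2l //.
by have := geom_tail R (ilog 6 s) (ilog 1 x).+1; lra.
Qed.

(** * Passage to relative density one among the cubefree integers *)

Section Density.
Variable R : realType.

Lemma count_upto_subset (A B : set nat) x : A `<=` B -> (count_upto A x <= count_upto B x)%N.
Proof.
move=> AB; apply: leq_sum => n _; case: (boolP (n \in A)) => // /set_mem/AB/mem_set ->.
by [].
Qed.

(** Telescoping: [1/p^3 <= 1/(2 p (p-1)) = F (p+1) - F p]. *)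
Lemma sum_inv_cube_le (x : nat) :
  \sum_(2 <= p < x.+1) ((p ^ 3)%:R : R)^-1 <= 1 / 2.
Proof.
have [x1|x1] := leqP x 1; first by rewrite big_geq // divr_ge0.
pose F (p : nat) : R := - (1 / 2) * (p.-1)%:R^-1.
apply: (@le_trans _ _ (\sum_(2 <= p < x.+1) (F p.+1 - F p))).
  rewrite big_nat_cond [leRHS]big_nat_cond; apply: ler_sum => p /andP[/andP[p1 _] _].
  rewrite /F natrX; case: p p1 => [//|[//|p]] _ /=.
  set y : R := p.+1%:R; have -> : p.+2%:R = y + 1 by rewrite natr1.
  have y1 : 1 <= y by rewrite ler1n.
  have -> : - (1 / 2) * (y + 1)^-1 - - (1 / 2) * y^-1 = (2 * y * (y + 1))^-1.
    by field; rewrite !gt_eqF //; lra.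
  rewrite lef_pV2 ?posrE ?exprn_gt0 ?mulr_gt0 //; try lra.
  by rewrite !exprS expr0; nra.
rewrite telescope_sumr; last by rewrite ltnW.
rewrite /F (_ : (2.-1)%N%:R = 1 :> R) // invr1 mulr1 succnK.
have : 0 <= (x%:R : R)^-1 by rewrite invr_ge0.
lra.
Qed.

(** A positive lower density of the cubefree integers turns an exceptional set of size o(x) into one
    of relative density zero. *)
Lemma count_cubefree_ge (x : nat) : x%:R / 2 <= (count_upto cubefree x)%:R :> R.
Proof.
have h : (x <= count_upto cubefree x +
    \sum_(2 <= p < x.+1) \sum_(1 <= n < x.+1) (p ^ 3 %| n))%N.
  have {1}-> : x = (\sum_(1 <= n < x.+1) 1)%N by rewrite sum_nat_const_nat muln1 subn1.
  rewrite exchange_big /count_upto /= -big_split /=.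
  rewrite big_nat_cond [leqRHS]big_nat_cond; apply: leq_sum => n /andP[/andP[n0 nx] _].
  case: (boolP (n \in cubefree)) => // ncf; rewrite add0n lt0n; apply: contra ncf.
  rewrite sum_nat_seq_eq0 => /allP h; apply/mem_set; split => // p pp.
  apply/negP=> pn; have pI : p \in index_iota 2 x.+1.
    rewrite mem_index_iota; apply/andP; split; first exact: prime_gt1.
    apply: leq_ltn_trans nx; apply: leq_trans (dvdn_leq n0 pn).
    by rewrite -[leqLHS]expn1 leq_pexp2l // prime_gt0.
  by have := h p pI; rewrite pn.
have : x%:R <= (count_upto cubefree x)%:R + x%:R * (1 / 2) :> R.
  apply: (@le_trans _ _ (_%:R)); first by rewrite ler_nat; exact: h.
  rewrite natrD lerD2l natr_sum.
  apply: (@le_trans _ _ (\sum_(2 <= p < x.+1) x%:R / (p ^ 3)%:R)).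
    rewrite big_nat_cond [leRHS]big_nat_cond; apply: ler_sum => p /andP[/andP[p1 _] _].
    by apply: sum_dvd_le; rewrite expn_gt0 (leq_trans _ p1).
  by rewrite -mulr_sumr ler_wpM2l // sum_inv_cube_le.
lra.
Qed.

Lemma ilog_cvgny k : ilog k n @[n --> \oo] --> \oo.
Proof.
elim: k => [|k IH]; first exact: cvg_id.
apply/cvgnyPge => A; have /cvgnyPge/(_ (2 ^ A)%N) := IH.
by apply: filterS => n h; apply: trunc_log_max.
Qed.

(** Roughly the square root of [x]: negligible against [x], while its logarithm is still about half
    of log x, so the cubed threshold in [badW] beats the average log x. *)
Definition scale x := (2 ^ (ilog 1 x)./2)%N.

Lemma half_ilog_cvgny : (ilog 1 x)./2 @[x --> \oo] --> \oo.
Proof.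
apply/cvgnyPge => A; have /cvgnyPge/(_ A.*2) := @ilog_cvgny 1.
by apply: filterS => n h; rewrite -(doubleK A) half_leq.
Qed.

(** For [M = ilog 1 (scale x)], a share [1/(M+1)] bounds [scale x / x], the other [2/(M+1)] comes
    from [badW], and the last term from the sieve blocks. *)
Definition err (M : nat) : R := 3 / M.+1%:R + 256 * (3 / 4) ^+ ilog 5 M.

Lemma err_cvg0 : err M @[M --> \oo] --> (0 : R).
Proof.
rewrite -[X in _ --> X]addr0; apply: cvgD.
  rewrite -[X in _ --> X](mulr0 3); apply: cvgMr; exact: cvg_harmonic.
rewrite -[X in _ --> X](mulr0 256); apply: cvgMr.
apply: (@cvg_comp _ _ _ (ilog 5) (fun j => (3 / 4 : R) ^+ j) _ \oo _ (ilog_cvgny 5)).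
apply: cvg_expr; rewrite ger0_norm; lra.
Qed.

Lemma count_typical_ge (x : nat) : (0 < x)%N -> (10 <= ilog 6 (scale x))%N ->
  1 - 2 * err (ilog 1 x)./2 <= (count_upto typical x)%:R / (count_upto cubefree x)%:R.
Proof.
move=> x0 hs; have := count_atypical_le R x hs; have := count_cubefree_ge x.
set M := (ilog 1 x)./2; set s := scale x.
have x0' : 0 < x%:R :> R by rewrite ltr0n.
have sM : ilog 1 s = M by rewrite /s /scale /= trunc_expnK.
have s6 : ilog 6 s = ilog 5 M by rewrite -sM /ilog -iterSr.
have M1 : (0 : R) < M.+1%:R by [].
have eS : s%:R <= x%:R * (1 / M.+1%:R) :> R.
  rewrite mulrA mulr1 ler_pdivlMr // -natrM ler_nat.
  (* Here [s = 2^M] exceeds [M], and [s^2 <= x]. *)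
  apply: (@leq_trans (s * s)); first by rewrite leq_mul2l ltn_expl // orbT.
  rewrite /s /scale -expnD addnn; apply: leq_trans (trunc_logP (isT : (1 < 2)%N) x0).
  by rewrite leq_exp2l // -[leqRHS]odd_double_half leq_addl.
have eW : (ilog 1 x).+1%:R / M.+1%:R ^+ 3 <= 2 / M.+1%:R :> R.
  have h : (ilog 1 x).+1%:R <= 2 * M.+1%:R :> R.
    rewrite -natrM ler_nat; have := odd_double_half (ilog 1 x); rewrite -/M.
    by have := leq_b1 (odd (ilog 1 x)); rewrite -muln2; lia.
  rewrite ler_pdivrMr ?exprn_gt0 //; apply: le_trans h _.
  have m1 : 1 <= M.+1%:R :> R by rewrite ler1n.
  have -> : 2 / M.+1%:R * M.+1%:R ^+ 3 = 2 * M.+1%:R * M.+1%:R :> R.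
    by field; rewrite gt_eqF.
  nra.
rewrite sM s6 => c1 c2.
have cpos : 0 < (count_upto cubefree x)%:R :> R by lra.
rewrite ler_pdivlMr // /err.
set c := (count_upto cubefree x)%:R in c1 c2 cpos *; set t := (count_upto typical x)%:R in c2 *.
have g0 : 0 <= (3 / 4 : R) ^+ ilog 5 M by rewrite exprn_ge0 //; lra.
move: eS eW g0 c2; rewrite -[3 / _]/(3 * _^-1) -[2 / _]/(2 * _^-1) div1r.
have : 0 <= (M.+1%:R : R)^-1 by rewrite invr_ge0.
move: (_^-1) ((3 / 4) ^+ _) (_ / _ ^+ 3) => m g w m0 eS eW g0 c2.
have : x%:R * (3 * m + 256 * g) <= 2 * c * (3 * m + 256 * g).
  by apply: ler_wpM2r; lra.
have : x%:R * w <= x%:R * (2 * m) by rewrite ler_wpM2l // ltW.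
lra.
Qed.

Lemma typical_density : relative_density_one R cubefree typical.
Proof.
have e0 : err (ilog 1 x)./2 @[x --> \oo] --> (0 : R).
  exact: (@cvg_comp _ _ _ (fun x => (ilog 1 x)./2) err _ \oo _ half_ilog_cvgny err_cvg0).
apply: (@squeeze_cvgr _ _ _ _ (fun x => 1 - 2 * err (ilog 1 x)./2) (fun=> 1)).
- have sc : scale x @[x --> \oo] --> \oo.
    apply/cvgnyPge => A; have /cvgnyPge/(_ A) := half_ilog_cvgny.
    by apply: filterS => n h; apply: leq_trans h _; apply/ltnW/ltn_expl.
  have : ilog 6 (scale x) @[x --> \oo] --> \oo.
    exact: (@cvg_comp _ _ _ scale (ilog 6) _ \oo _ sc (ilog_cvgny 6)).
  move=> /cvgnyPge/(_ 10%N) h; near=> x; apply/andP; split.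
    apply: count_typical_ge; near: x => //; exact: nbhs_infty_gt.
  (* A zero denominator makes the quotient 0 by convention. *)
  have [->|c0] := eqVneq (count_upto cubefree x) 0%N; first by rewrite invr0 mulr0.
  rewrite ler_pdivrMr ?ltr0n ?lt0n // mul1r ler_nat; apply: count_upto_subset.
  by move=> n [].
- rewrite -[X in _ --> X](subr0 1) -[X in _ - X](mulr0 2).
  by apply: cvgB; [exact: cvg_cst | apply: cvgMr].
- exact: cvg_cst.
Unshelve. all: by end_near.
Qed.

End Density.

(** * Growth of iterated logarithms *)

Section Growth.
Variable R : realType.

(** Equivalent to [e^(1/2) <= 2], which follows from [e^(-1/2) >= 1 - 1/2]. *)
Lemma ln2_ge : 1 / 2 <= ln 2 :> R.
Proof.
rewrite -ler_expR lnK ?posrE //.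
have := expR_ge1Dx (- (1 / 2) : R); rewrite expRN => h.
have p := expR_gt0 (1 / 2 : R).
have : expR (1 / 2) * (1 + - (1 / 2)) <= expR (1 / 2) * (expR (1 / 2))^-1 :> R.
  by rewrite ler_pM2l.
rewrite mulfV ?gt_eqF //; lra.
Qed.

Lemma ln_ge_trunc_log (y : R) (n : nat) : (0 < n)%N -> n%:R <= y ->
  (trunc_log 2 n)%:R / 2 <= ln y.
Proof.
move=> n0 ny; have y0 : 0 < y by apply: lt_le_trans ny; rewrite ltr0n.
apply: (@le_trans _ _ (ln ((2 : R) ^+ trunc_log 2 n))).
  rewrite lnXn // -[leRHS]mulr_natl ler_wpM2l //; have := ln2_ge; lra.
rewrite ler_ln ?posrE ?exprn_gt0 //; apply: le_trans ny.
by rewrite -natrX ler_nat trunc_logP.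
Qed.

(** With [l = ilog 2 n], first [ln n >= 2^(l-1)], then [ln (ln n) >= (l-1)/2 >= l/4]. *)
Lemma lnln_ge (n : nat) : (4 <= ilog 2 n)%N ->
  (ilog 2 n)%:R / 4 <= ln (ln n%:R) :> R.
Proof.
move=> h2; have [h1 p1] := @ilogS_gt0 1 n (leq_trans (isT : 0 < 4)%N h2).
have [h0 p0] := ilogS_gt0 h1; rewrite /= in h0 h1.
have l1 := ln_ge_trunc_log h0 (lexx (n%:R : R)).
have c : (2 ^ (ilog 2 n).-1)%:R <= ln n%:R :> R.
  apply: le_trans l1; rewrite ler_pdivlMr // -natrM ler_nat -expnSr prednK //.
  exact: leq_trans h2.
have := ln_ge_trunc_log _ c; rewrite expn_gt0 trunc_expnK // => /(_ isT).
apply: le_trans; rewrite ler_pdivlMr // mulrAC ler_pdivrMr // -!natrM ler_nat.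
by case: (ilog 2 n) h2 => // k; rewrite succnK; lia.
Qed.

Lemma gnu_le_expR (n : nat) : typical n ->
  [/\ 1 < ln n%:R :> R, 1 < ln (ln n%:R) :> R &
    (gnu n)%:R <= expR (ln (ln n%:R) ^+ 8) :> R].
Proof.
move=> [[n0 cn] gn wn Jn]; have [_ _ l0] := ilog_tower Jn.
have := gnu_le_main n0 cn gn Jn wn; set l := ilog 2 n in l0 * => gl.
have u0 : l%:R / 4 <= ln (ln n%:R) :> R by apply: lnln_ge; apply: leq_trans l0.
have l0' : 1000 <= l%:R :> R by rewrite ler_nat.
set u := ln (ln n%:R) in u0 *.
have u1 : 1 < u by lra.
split=> //.
  rewrite ltNge; apply/negP=> /(ln_le0); rewrite -/u; lra.
apply: (@le_trans _ _ (2 ^+ (l ^ 6))); first by rewrite -natrX ler_nat.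
apply: (@le_trans _ _ (expR ((l ^ 6)%:R * 1))).
  rewrite expRM_natl; apply: lerXn2r; rewrite ?nnegrE ?expR_ge0 //.
  by have := expR_ge1Dx (1 : R); lra.
rewrite ler_expR mulr1 natrX; apply: (@le_trans _ _ ((l%:R / 4) ^+ 8)); last first.
  by apply: lerXn2r => //; rewrite nnegrE; lra.
have {u0 u1} : 250 <= l%:R / 4 :> R by lra.
have -> : (l%:R : R) ^+ 6 = (4 * (l%:R / 4)) ^+ 6 by rewrite mulrC divfK.
move: (l%:R / 4) => z z1.
(* The two spare powers of [z] absorb [4^6]: [z^8 >= (4^3)^2 z^6]. *)
have h4 : 4 ^+ 3 <= z by rewrite !exprS expr0; lra.
rewrite exprMn (exprD z 2 6) (exprM 4 3 2) ler_wpM2r ?exprn_ge0 //; first lra.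
by apply: lerXn2r => //; rewrite nnegrE; lra.
Qed.

(** The exponential satisfies [e^u = (e^(u/16))^16 >= (u/16)^16], and [16^16 = 256^8]. *)
Lemma pow_div_exp_le (u : R) : 0 < u -> u ^+ 8 / expR u <= 256 ^+ 8 / u ^+ 8.
Proof.
move=> u0; rewrite ler_pdivrMr ?expR_gt0 // mulrAC ler_pdivlMr ?exprn_gt0 //.
have -> : expR u = expR (u / 16) ^+ 16.
  by rewrite -expRM_natl mulrC divfK.
have := expR_ge1Dx (u / 16); have uv : u = 16 * (u / 16) by rewrite mulrC divfK.
set e := expR _ => h; apply: (@le_trans _ _ (256 ^+ 8 * (u / 16) ^+ 16)); last first.
  apply: ler_wpM2l; first exact: exprn_ge0.
  apply: lerXn2r; rewrite ?nnegrE ?expR_ge0 ?divr_ge0 ?ltW //; lra.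
rewrite {1 2}uv; move: (u / 16) => v.
have -> : 256 = 16 * 16 :> R by rewrite -natrM.
by rewrite !exprMn (exprD v 8 8 : v ^+ 16 = _) mulrACA lexx.
Qed.

Lemma eps_cvg0 :
  ln (ln n%:R) ^+ 8 / ln n%:R @[n --> \oo] --> (0 : R).
Proof.
apply: (@squeeze_cvgr _ _ _ _ (fun=> 0) (fun n => (4 * 256 ^+ 8) * (ilog 2 n).+1%:R^-1 * 2)).
- have /cvgnyPge/(_ 1000%N) := ilog_cvgny 2; apply: filterS => n l0.
  have u0 : (ilog 2 n)%:R / 4 <= ln (ln n%:R) :> R by apply: lnln_ge; apply: leq_trans l0.
  have l0' : 1000 <= (ilog 2 n)%:R :> R by rewrite ler_nat.
  set u := ln (ln n%:R) in u0 *.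
  have u1 : 1 < u by lra.
  have lp : 0 < ln n%:R :> R.
    by rewrite ltNge; apply/negP=> /ln0; rewrite -/u; lra.
  apply/andP; split; first by rewrite divr_ge0 ?exprn_ge0 // ltW //; lra.
  have -> : ln n%:R = expR u by rewrite lnK // posrE.
  apply: le_trans (pow_div_exp_le _) _; first lra.
  have k1 : (ilog 2 n).+1%:R <= 8 * u by rewrite -natr1; lra.
  have k0 : 0 < (ilog 2 n).+1%:R :> R by rewrite ltr0n.
  have -> : 4 * 256 ^+ 8 * (ilog 2 n).+1%:R^-1 * 2 =
      256 ^+ 8 * (8 * (ilog 2 n).+1%:R^-1) :> R.
    by move: (256 ^+ 8) (_^-1) => a b; lra.
  apply: ler_wpM2l; first exact: exprn_ge0.
  rewrite ler_pdivlMr // ler_pdivrMl ?exprn_gt0 //; last lra.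
  apply: le_trans k1 _; rewrite mulrC ler_wpM2r // exprS.
  rewrite -{1}[u]mulr1 ler_wpM2l ?exprn_ege1 //; lra.
- exact: cvg_cst.
rewrite -[X in _ --> X](mul0r 2); apply: cvgMl; rewrite -[X in _ --> X](mulr0 (4 * 256 ^+ 8)); apply: cvgMr.
exact: (@cvg_comp _ _ _ (ilog 2) (fun k => k.+1%:R^-1 : R) _ \oo _ (ilog_cvgny 2) (@cvg_harmonic R)).
Qed.

End Growth.

Theorem theoremB (R : realType) :
  exists (c : R) (T : set nat),
    [/\ 0 < c,
        T `<=` cubefree,
        relative_density_one R cubefree T,
        forall n : nat, T n ->
          (gnu n)%:R <= ln (n%:R : R) `^ (ln (ln (n%:R : R)) `^ c)
      & exists eps : nat -> R,
          eps n @[n --> within T \oo] --> (0 : R) /\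
          forall n : nat, T n -> (gnu n)%:R <= (n%:R : R) `^ eps n].
Proof.
(* For [u = log log n] we have [log n = e^u], so the bound [e^(u^8)] equals [(log n)^(u^7)], whence
   [c = 7]. *)
exists 7%:R, typical; split => //.
- by move=> n [].
- exact: typical_density.
- move=> n /(gnu_le_expR R)[l1 u1 h]; apply: le_trans h _.
  rewrite powR_mulrn; last lra.
  by rewrite /powR gt_eqF; [rewrite -exprSr | lra].
(* Since [n^eps = e^(eps log n)], this choice makes the right side exactly [e^(u^8)]. *)
exists (fun n => ln (ln n%:R) ^+ 8 / ln n%:R); split.
  by apply: cvg_within_filter; apply: eps_cvg0.
move=> n Tn; have [l1 u1 h] := gnu_le_expR R Tn; apply: le_trans h _.
have n0 : n%:R != 0 :> R by apply/eqP=> n0; move: l1; rewrite n0 ln0 //; lra.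
by rewrite /powR (negbTE n0) divfK // gt_eqF //; lra.
Qed.
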